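(* Let $\ell_1,\ell_2,\ell_3,\ell_4,m_1,m_2,m_3,m_4$ be eight generic oriented lines (in the hyperbolic, elliptic, or Euclidean plane) touching a common hypercycle. If the three quadrilaterals $(\ell_1,\ell_2,m_1,m_2)$, $(\ell_2,\ell_3,m_2,m_3)$, $(\ell_3,\ell_4,m_3,m_4)$ are circumscribed, then so is the quadrilateral $(\ell_1,\ell_4,m_1,m_4)$.
   Context: Let $\varepsilon=-1,1,0$ in the hyperbolic, elliptic, Euclidean case. The Laguerre quadric is $\mathcal{B}=\{[x]\in\mathbb{R}\mathrm{P}^3: x_1^2+x_2^2+\varepsilon x_3^2-x_4^2=0\}$. Oriented lines of the respective plane are identified with points of $\mathcal{B}$ (for $\varepsilon=0$ excluding the vertex $[0,0,1,0]$); oriented (Laguerre) circles are identified with planar sections of $\mathcal{B}$. A quadrilateral of four oriented lines is circumscribed if the four lines touch a common oriented circle, i.e. if the four corresponding points of $\mathcal{B}$ are coplanar. A hypercycle is the family of oriented lines corresponding to the points of an intersection $\mathcal{B}\cap\mathcal{Q}'$ of $\mathcal{B}$ with another quadric $\mathcal{Q}'\neq\mathcal{B}$ (the hypercycle base curve). A line touches the hypercycle if its point lies on the hypercycle base curve. Generic means: the eight points on $\mathcal{B}$ are pairwise distinct, no five of them are coplanar, and the plane containing $\ell_1,\ell_2,m_1,m_2$ and the plane containing $\ell_3,\ell_4,m_3,m_4$ each meet the hypercycle base curve in exactly four points. *)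

(* Defs.v *)
From HB Require Import structures.
From mathcomp Require Import all_boot all_order all_algebra.
From mathcomp Require Import classical_sets cardinality reals.
Set Implicit Arguments.
Unset Strict Implicit.
Unset Printing Implicit Defensive.

Import Order.TTheory GRing.Theory Num.Theory.
Local Open Scope ring_scope.
Local Open Scope classical_set_scope.

(* A point [x] of RP^3 is the line <[x]> of R^4 spanned by x != 0, so that [=]
   is equality of projective points. *)
Record RP3 (R : realType) := ProjectivePoint {
  line_of : {vspace 'rV[R]_4};
  _ : \dim line_of == 1%N
}.

HB.instance Definition _ (R : realType) := [isSub for @line_of R].
HB.instance Definition _ (R : realType) := [Choice of RP3 R by <:].

Definition plane (R : realType) (W : {vspace 'rV[R]_4}) : set (RP3 R) :=
  [set p : RP3 R | (line_of p <= W)%VS].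

Definition is_plane (R : realType) (P : set (RP3 R)) : Prop :=
  exists2 W : {vspace 'rV[R]_4}, \dim W = 3%N & P = plane W.

Definition quadric (R : realType) (A : 'M[R]_4) : set (RP3 R) :=
  [set p : RP3 R | forall x : 'rV[R]_4, x \in line_of p ->
     (x *m A *m x^T) 0 0 = 0].

(* Degenerate quadrics are allowed; only the zero form is not. *)
Definition is_quadric (R : realType) (Q : set (RP3 R)) : Prop :=
  exists A : 'M[R]_4, [/\ A^T = A, A != 0 & Q = quadric A].

Inductive geometry := Hyperbolic | Elliptic | Euclidean.

Definition eps (R : realType) (g : geometry) : R :=
  match g with Hyperbolic => -1 | Elliptic => 1 | Euclidean => 0 end.

(* The indices 0, 1, 2, 3 : 'I_4 stand for the coordinates x_1, x_2, x_3, x_4. *)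
Definition laguerre_quadric (R : realType) (g : geometry) : set (RP3 R) :=
  [set p : RP3 R | forall x : 'rV[R]_4, x \in line_of p ->
     x 0 0 ^+ 2 + x 0 1 ^+ 2 + eps R g * x 0 2 ^+ 2 - x 0 3 ^+ 2 = 0].

Definition oriented_line (R : realType) (g : geometry) (l : RP3 R) : Prop :=
  laguerre_quadric g l /\
  (g = Euclidean -> line_of l <> <[(delta_mx 0 2)%R]>%VS).

Definition oriented_circle (R : realType) (g : geometry) (S : set (RP3 R)) :
    Prop :=
  exists2 P, is_plane P & S = laguerre_quadric g `&` P.

Definition circumscribed (R : realType) (g : geometry) (a b c d : RP3 R) :
    Prop :=
  exists2 S, oriented_circle g S & [/\ S a, S b, S c & S d].

(* The base curve is all of B `&` Q': in the Euclidean case it contains the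
   vertex [0,0,1,0] when Q' does. *)
Definition hypercycle_base_curve (R : realType) (g : geometry)
    (C : set (RP3 R)) : Prop :=
  exists Q, [/\ is_quadric Q, Q <> laguerre_quadric g
             & C = laguerre_quadric g `&` Q].

Definition touches_hypercycle (R : realType) (g : geometry)
    (C : set (RP3 R)) (l : RP3 R) : Prop :=
  oriented_line g l /\ C l.

Definition no_five_coplanar (R : realType) (s : seq (RP3 R)) : Prop :=
  forall t : seq (RP3 R), uniq t -> size t = 5%N -> {subset t <= s} ->
    ~ exists2 P, is_plane P & {in t, forall p, P p}.

Definition plane_meets_in_four (R : realType) (C : set (RP3 R))
    (a b c d : RP3 R) : Prop :=
  forall P, is_plane P -> [/\ P a, P b, P c & P d] -> (P `&` C #= `I_4)%card.

Definition generic (R : realType) (C : set (RP3 R))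
    (l1 l2 l3 l4 m1 m2 m3 m4 : RP3 R) : Prop :=
  [/\ uniq [:: l1; l2; l3; l4; m1; m2; m3; m4],
      no_five_coplanar [:: l1; l2; l3; l4; m1; m2; m3; m4],
      plane_meets_in_four C l1 l2 m1 m2
    & plane_meets_in_four C l3 l4 m3 m4].

(* Main.v *)
(* Let F be the product of linear forms cutting out the plane of l2, l3, m2, m3
   and a plane through l1, l4, m1; it vanishes at every point but possibly m4.
   In the plane W of l1, l2, m1, m2, the conics through these four points form a
   pencil, spanned by the restrictions of B and Q' because the four points are
   all of W /\ B /\ Q'.  Hence some G = F - u B - v Q' vanishes on W, so G is W
   times another plane; the latter contains l3, l4, m3, hence m4.  Thus F
   vanishes at m4, and m4 is not in the plane of l2, l3, m2, m3. *)
Require Import Defs.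
From HB Require Import structures.
From mathcomp Require Import all_boot all_order all_algebra.
From mathcomp Require Import classical_sets cardinality reals.
From mathcomp Require Import ring lra.
Set Implicit Arguments.
Unset Strict Implicit.
Unset Printing Implicit Defensive.

Import Order.TTheory GRing.Theory Num.Theory.
Local Open Scope ring_scope.

(** * Bilinear forms given by 4 by 4 matrices *)

Definition bil (R : realType) (A : 'M[R]_4) (x y : 'rV[R]_4) : R :=
  (x *m A *m y^T) 0 0.

Section Bilinear.
Variable R : realType.
Implicit Types (A B : 'M[R]_4) (x y z : 'rV[R]_4) (f g : 'cV[R]_4) (a : R).

Lemma bilDl A x y z : bil A (x + y) z = bil A x z + bil A y z.
Proof. by rewrite /bil !mulmxDl mxE. Qed.

Lemma bilDr A x y z : bil A z (x + y) = bil A z x + bil A z y.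
Proof. by rewrite /bil linearD mulmxDr mxE. Qed.

Lemma bilZl A a x y : bil A (a *: x) y = a * bil A x y.
Proof. by rewrite /bil -!scalemxAl mxE. Qed.

Lemma bilZr A a x y : bil A x (a *: y) = a * bil A x y.
Proof. by rewrite /bil linearZ -scalemxAr mxE. Qed.

Lemma bil_comb A B C a b x y :
  bil (A - a *: B - b *: C) x y = bil A x y - a * bil B x y - b * bil C x y.
Proof.
by rewrite /bil !(mulmxBr, mulmxBl) -!(scalemxAl, scalemxAr) !mxE.
Qed.

Lemma bil_prod f g x y : bil (f *m g^T) x y = (x *m f) 0 0 * (y *m g) 0 0.
Proof.
rewrite /bil mulmxA -mulmxA -trmx_mul mxE big_ord1.
by congr (_ * _); rewrite mxE.
Qed.

End Bilinear.

Definition bilE := (bilDl, bilDr, bilZl, bilZr).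

(** * Homogeneous coordinates of projective points *)

Section ProjectivePoints.
Variable R : realType.
Implicit Types (p q : RP3 R) (x y z v : 'rV[R]_4) (W : {vspace 'rV[R]_4})
  (f : 'cV[R]_4).

Definition represents p x := x != 0 /\ line_of p = <[x]>%VS.

Lemma represents_exists p : exists x, represents p x.
Proof.
exists (vpick (line_of p)).
have /eqP dimW : \dim (line_of p) == 1%N by exact: valP p.
have pick0 : vpick (line_of p) != 0 by rewrite vpick0 -dimv_eq0 dimW.
split=> //; apply/esym/eqP.
by rewrite eqEdim -memvE memv_pick /= dimW dim_vline pick0.
Qed.

Lemma represents_point x : x != 0 -> exists p, represents p x.
Proof.
move=> x0; have dimx : \dim <[x]> == 1%N by rewrite dim_vline x0.
by exists (ProjectivePoint dimx).
Qed.

Lemma representsZ p x a : a != 0 -> represents p x -> represents p (a *: x).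
Proof.
move=> a0 [x0 px]; split; first by rewrite scaler_eq0 negb_or a0.
rewrite px; apply/eqP.
rewrite eqEdim !dim_vline scaler_eq0 (negPf a0) (negPf x0).
rewrite -memvE andbT; apply/vlineP; exists a^-1.
by rewrite scalerA mulVf ?scale1r.
Qed.

Lemma represents_indep p q x y a b :
  p != q -> represents p x -> represents q y ->
  a *: x + b *: y = 0 -> a = 0 /\ b = 0.
Proof.
move=> pq [x0 px] [y0 qy] xy0.
have a0 : a = 0.
  apply: contraNeq pq => a0; apply/eqP/val_inj => /=.
  rewrite px qy; apply/eqP; rewrite eqEdim !dim_vline x0 y0 -memvE andbT.
  apply/vlineP; exists (- (b / a)); apply: (scalerI a0).
  rewrite scalerA mulrN mulrCA mulfV // mulr1 scaleNr.
  by apply/eqP; rewrite -addr_eq0 xy0.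
split=> //; move/eqP: xy0; rewrite a0 scale0r add0r scaler_eq0 (negPf y0) orbF.
by move/eqP.
Qed.

Lemma represents_neq p q x y : represents p x -> represents q y ->
  (forall a, x = a *: y -> False) -> p != q.
Proof.
move=> [x0 px] [y0 qy] H; apply/eqP => pq.
have : x \in <[y]>%VS by rewrite -qy -pq px memv_line.
by case/vlineP => a; apply: H.
Qed.

(** Quadratic forms are homogeneous, so one spanning vector decides whether the point lies on the
    quadric. *)
Lemma quadricE (A : 'M[R]_4) p x :
  represents p x -> quadric A p <-> bil A x x = 0.
Proof.
move=> [_ px]; rewrite /quadric /=; split=> [H|H y].
  by apply: H; rewrite px memv_line.
by rewrite px => /vlineP[a ->]; rewrite -/(bil _ _ _) !bilE H !mulr0.
Qed.

Lemma planeE W p x : represents p x -> plane W p <-> x \in W.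
Proof. by move=> [_ px]; rewrite /plane /= px -memvE. Qed.

Definition laguerre_mx (g : geometry) : 'M[R]_4 :=
  diag_mx (\row_i nth 0 [:: 1; 1; eps R g; -1] i).

(** Brings the Laguerre quadric into matrix form, so that it and the second quadric enter the pencil
    alike. *)
Lemma laguerre_quadricE g : laguerre_quadric g = quadric (laguerre_mx g).
Proof.
have E (x : 'rV[R]_4) : (x *m laguerre_mx g *m x^T) 0 0 =
    x 0 0 ^+ 2 + x 0 1 ^+ 2 + eps R g * x 0 2 ^+ 2 - x 0 3 ^+ 2.
  rewrite mul_mx_diag mxE !big_ord_recl big_ord0 !mxE /=.
  have -> : lift ord0 ord0 = 1 :> 'I_4 by exact/val_inj.
  have -> : lift ord0 (lift ord0 ord0) = 2 :> 'I_4 by exact/val_inj.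
  have -> : lift ord0 (lift ord0 (lift ord0 ord0)) = 3 :> 'I_4.
    exact/val_inj.
  by rewrite /=; ring.
by apply/seteqP; split=> p H x /H; rewrite E.
Qed.

End ProjectivePoints.

(** * Planes as kernels of linear forms *)

Section LinearForms.
Variable R : realType.
Implicit Types (x y z : 'rV[R]_4) (W : {vspace 'rV[R]_4}) (f : 'cV[R]_4).

Lemma formB f x y : ((x - y) *m f) 0 0 = (x *m f) 0 0 - (y *m f) 0 0.
Proof. by rewrite mulmxBl; move: (_ *m f) (_ *m f) => X Y; rewrite !mxE. Qed.

Lemma form_comb f x y z a b c : ((a *: x + b *: y + c *: z) *m f) 0 0 =
  a * (x *m f) 0 0 + b * (y *m f) 0 0 + c * (z *m f) 0 0.
Proof.
rewrite !mulmxDl -!scalemxAl; move: (x *m f) (y *m f) (z *m f) => X Y Z.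
by rewrite !mxE.
Qed.

(** Three linear conditions on four coefficients: a 4 by 3 matrix has a nonzero left kernel. *)
Lemma form_through x y z : exists2 f : 'cV[R]_4, f != 0 &
  [/\ (x *m f) 0 0 = 0, (y *m f) 0 0 = 0 & (z *m f) 0 0 = 0].
Proof.
pose M : 'M[R]_(4, 3) := (\matrix_(i < 3, j < 4) [:: x; y; z]`_i 0 j)^T.
have : kermx M != 0.
  by rewrite kermx_eq0 /row_free neq_ltn (leq_ltn_trans (rank_leq_col M)).
case/rowV0Pn => v /sub_kermxP vM v0; exists v^T.
  by rewrite -trmx0 (inj_eq trmx_inj).
have E (i : 'I_3) : ([:: x; y; z]`_i *m v^T) 0 0 = 0.
  have := congr1 (fun A : 'M_(1, 3) => A 0 i) vM; rewrite !mxE => vMi.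
  by rewrite -[RHS]vMi; apply: eq_bigr => j _; rewrite !mxE mulrC.
by split; [exact: (E 0)|exact: (E 1)|exact: (E 2)].
Qed.

(** Rank-nullity: the image has dimension at most 1, and it is nonzero because the unit vectors
    recover the coefficients of [f]. *)
Lemma ker_form f : f != 0 ->
  exists2 W, \dim W = 3%N & forall x, (x \in W) = ((x *m f) 0 0 == 0).
Proof.
move=> f0; pose phi : 'Hom('rV[R]_4, 'rV[R]_1) := linfun (mulmxr f).
have kerE x : (x \in lker phi) = ((x *m f) 0 0 == 0).
  rewrite memv_ker lfunE /=; apply/eqP/eqP => [->|x0]; first by rewrite mxE.
  by rewrite [LHS]mx11_scalar x0 -scalemx1 scale0r.
exists (lker phi) => //.
have := limg_ker_dim phi fullv; rewrite capfv dimvf dim_matrix.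
have : (\dim (phi @: fullv) <= 1)%N.
  by rewrite (leq_trans (dimvS (subvf _))) ?dimvf ?dim_matrix.
suff : \dim (phi @: fullv) != 0%N.
  by case: (\dim (limg phi)) => [|[|k]] // _ _; rewrite addn1 => -[].
rewrite dimv_eq0; apply: contraNneq f0 => img0.
apply/eqP/matrixP => i j; rewrite ord1 mxE.
have : delta_mx 0 i \in lker phi.
  by rewrite memv_ker -memv0 -img0 memv_img ?memvf.
by rewrite kerE -rowE mxE => /eqP.
Qed.

(** A nonzero form vanishing on a basis of [W] has a kernel that contains [W] and has the same
    dimension. *)
Lemma plane_form W : \dim W = 3%N ->
  exists f, forall x, (x \in W) = ((x *m f) 0 0 == 0).
Proof.
move=> dimW; pose b : seq 'rV[R]_4 := vbasis W.
have szb : size b = 3%N by rewrite size_tuple.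
have [f f0 [h0 h1 h2]] := form_through b`_0 b`_1 b`_2.
have [V dimV VE] := ker_form f0; exists f => x; rewrite -VE.
suff -> : W = V by [].
apply/eqP; rewrite eqEdim dimW dimV leqnn andbT.
rewrite -(span_basis (vbasisP W)); apply/span_subvP => v /(nthP 0)[i].
rewrite -/b szb VE => + <-.
by case: i => [|[|[|i]]] // _; rewrite ?h0 ?h1 ?h2.
Qed.

Lemma mem_span3 x y z v : v \in <<[:: x; y; z]>>%VS ->
  exists a b c, v = a *: x + b *: y + c *: z.
Proof.
rewrite !span_cons span_nil addv0.
move=> /memv_addP[_ /vlineP[a ->]] [w + ->].
move=> /memv_addP[_ /vlineP[b ->]] [_ /vlineP[c ->] ->].
by exists a, b, c; rewrite addrA.
Qed.

Lemma mem_plane3 W x y z v : \dim W = 3%N -> free [:: x; y; z] ->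
  x \in W -> y \in W -> z \in W -> v \in W ->
  exists a b c, v = a *: x + b *: y + c *: z.
Proof.
move=> dimW fr xW yW zW vW; apply: mem_span3.
suff -> : <<[:: x; y; z]>>%VS = W by [].
apply/eqP; rewrite eqEdim dimW (eqnP fr) leqnn andbT.
by apply/span_subvP => u; rewrite !inE => /or3P[] /eqP->.
Qed.

Lemma free3 x y z :
  (forall a b c, a *: x + b *: y + c *: z = 0 -> [/\ a = 0, b = 0 & c = 0]) ->
  free [:: x; y; z].
Proof.
move=> H; apply/(@freeP _ _ _ [tuple x; y; z]) => k.
rewrite !big_ord_recl big_ord0 addr0 /= addrA => /H[k0 k1 k2] i.
by case: i => -[|[|[|i]]] // lti;
  [rewrite -[RHS]k0|rewrite -[RHS]k1|rewrite -[RHS]k2];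
  congr (k _); apply: val_inj.
Qed.

Lemma free3P x y z a b c : free [:: x; y; z] ->
  a *: x + b *: y + c *: z = 0 -> [/\ a = 0, b = 0 & c = 0].
Proof.
move=> /(@freeP _ _ _ [tuple x; y; z]) fr e.
have E (i : 'I_3) : [:: a; b; c]`_i = 0.
  apply: (fr (fun i : 'I_3 => [:: a; b; c]`_i)).
  by rewrite !big_ord_recl big_ord0 addr0 /= addrA.
by split; [exact: (E 0)|exact: (E 1)|exact: (E 2)].
Qed.

End LinearForms.

(** * Pencils of plane conics through four points *)

Section Conics.
Variable F : realFieldType.
Implicit Types a b c : F.

(** The conic passes through the coordinate points and [1, 1, 1]; the three inequalities keep the
    new point away from all four. It is found on a line [x = s * z] through [0, 1, 0], which in
    general meets the conic once more. *)
Lemma conic_fifth_point a b : exists x y z, [/\ x != 0, z != 0, x != z &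
  a * x * y + b * y * z - (a + b) * x * z = 0].
Proof.
have from s : s != 0 -> s != 1 -> a * s + b != 0 ->
    exists x y z, [/\ x != 0, z != 0, x != z &
      a * x * y + b * y * z - (a + b) * x * z = 0].
  move=> s0 s1 d0; exists (s * (a * s + b)), ((a + b) * s), (a * s + b).
  split=> //; [by rewrite mulf_neq0| |by ring].
  by rewrite -subr_eq0 -{2}[a * s + b]mul1r -mulrBl mulf_neq0 ?subr_eq0.
(* The slope 2 fails only if [a * 2 + b = 0]. If moreover [a = 0], the conic is zero and any point
   serves; otherwise slope 3 works, since then [a * 3 + b = a]. *)
have [ab2|ab2] := eqVneq (a * 2 + b) 0; last first.
  by apply: (from 2) => //; [rewrite pnatr_eq0|rewrite (eqr_nat F 2 1)].
have [a0|a0] := eqVneq a 0.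
  exists 2, 0, 1; split; rewrite ?pnatr_eq0 ?oner_eq0 ?(eqr_nat F 2 1) //.
  have b0 : b = 0 by move: ab2; rewrite a0 mul0r add0r.
  by rewrite a0 b0; ring.
apply: (from 3) => //; [by rewrite pnatr_eq0|by rewrite (eqr_nat F 3 1)|].
suff -> : a * 3 + b = a by [].
by rewrite -[RHS]addr0 -ab2; ring.
Qed.

(* The conics [a xy + b yz + c xz] with [a + b + c = 0] are those through the
   three coordinate points and [1, 1, 1]. *)
Lemma conic_pencil a1 b1 c1 a2 b2 c2 a b c :
  a1 + b1 + c1 = 0 -> a2 + b2 + c2 = 0 -> a + b + c = 0 ->
  (exists u v, [/\ a = u * a1 + v * a2, b = u * b1 + v * b2
                 & c = u * c1 + v * c2]) \/
  (exists x y z, [/\ x != 0, z != 0, x != z,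
     a1 * x * y + b1 * y * z + c1 * x * z = 0 &
     a2 * x * y + b2 * y * z + c2 * x * z = 0]).
Proof.
move=> e1 e2 e.
have -> : c1 = - (a1 + b1) by lra.
have -> : c2 = - (a2 + b2) by lra.
have -> : c = - (a + b) by lra.
move=> {e1 e2 e}.
(* As the third coefficient is determined by the other two, this minor decides independence; when it
   is nonzero, Cramer's rule gives [u] and [v]. *)
have [k0|k0] := eqVneq (a1 * b2 - a2 * b1) 0; last first.
  left; exists ((a * b2 - a2 * b) / (a1 * b2 - a2 * b1)),
    ((a1 * b - a * b1) / (a1 * b2 - a2 * b1)).
  by split; field.
(* The conics are now proportional: a fifth point of the first, if that one is nonzero, lies on the
   second. If the first is zero, the second supplies the point. *)
right; have [a10|a10] := eqVneq a1 0; last first.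
  have [x [y [z [x0 z0 xz e]]]] := conic_fifth_point a1 b1.
  exists x, y, z; split=> //; first by rewrite -[RHS]e; ring.
  apply: (mulfI a10); rewrite mulr0.
  transitivity (a2 * (a1 * x * y + b1 * y * z - (a1 + b1) * x * z) +
    (a1 * b2 - a2 * b1) * (y * z - x * z)); first by ring.
  by rewrite e k0; ring.
have [b10|b10] := eqVneq b1 0; last first.
  have [x [y [z [x0 z0 xz e]]]] := conic_fifth_point a1 b1.
  exists x, y, z; split=> //; first by rewrite -[RHS]e; ring.
  apply: (mulfI b10); rewrite mulr0.
  transitivity (b2 * (a1 * x * y + b1 * y * z - (a1 + b1) * x * z) -
    (a1 * b2 - a2 * b1) * (x * y - x * z)); first by ring.
  by rewrite e k0; ring.
have [x [y [z [x0 z0 xz e]]]] := conic_fifth_point a2 b2.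
exists x, y, z; split=> //; first by rewrite a10 b10; ring.
by rewrite -[RHS]e; ring.
Qed.

End Conics.

(** * Quadratic forms in coordinates of a plane *)

Section QuadricPencil.
Variable R : realType.
Implicit Types (A G : 'M[R]_4) (W : {vspace 'rV[R]_4}) (x y z : 'rV[R]_4).

(** Symmetrised explicitly, since the matrix [f *m g^T] of a product of two linear forms need not be
    symmetric. *)
Definition polar A x y := bil A x y + bil A y x.

Lemma bil_comb3 A e1 e2 e3 (x y z : R) :
  bil A e1 e1 = 0 -> bil A e2 e2 = 0 -> bil A e3 e3 = 0 ->
  bil A (x *: e1 + y *: e2 + z *: e3) (x *: e1 + y *: e2 + z *: e3) =
  polar A e1 e2 * x * y + polar A e2 e3 * y * z + polar A e1 e3 * x * z.
Proof. by move=> h1 h2 h3; rewrite !bilE h1 h2 h3 /polar; ring. Qed.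

(* Modulo W, the form G is linear along the affine plane p1 + W. *)
Lemma vanish_affine_comb G W p1 p2 p3 (a b c : R) :
  {in W, forall w, bil G w w = 0} ->
  p2 - p1 \in W -> p3 - p1 \in W -> a + b + c = 1 ->
  bil G p1 p1 = 0 -> bil G p2 p2 = 0 -> bil G p3 p3 = 0 ->
  bil G (a *: p1 + b *: p2 + c *: p3) (a *: p1 + b *: p2 + c *: p3) = 0.
Proof.
move=> GW; set w2 := p2 - p1; set w3 := p3 - p1 => w2W w3W abc g1 g2 g3.
have e2 : p2 = p1 + w2 by rewrite /w2 addrC subrK.
have e3 : p3 = p1 + w3 by rewrite /w3 addrC subrK.
clearbody w2 w3.
have -> : a *: p1 + b *: p2 + c *: p3 = p1 + (b *: w2 + c *: w3).
  rewrite e2 e3 !scalerDr -[in RHS](scale1r p1) -abc !scalerDl -!addrA.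
  by congr (_ + _); congr (_ + _); rewrite addrCA.
have GX : bil G (b *: w2 + c *: w3) (b *: w2 + c *: w3) = 0.
  by apply: GW; rewrite rpredD ?rpredZ.
move: g2 g3; rewrite e2 e3 !(bilDl _ p1) !(bilDr _ p1) g1 GX !GW // !bilE.
move=> g2 g3.
(* Only the mixed terms with [p1] survive, and each vanishes because [G] is zero at [p2] or [p3]. *)
transitivity (b * (bil G p1 w2 + bil G w2 p1) +
  c * (bil G p1 w3 + bil G w3 p1)).
  by ring.
by move: g2 g3; rewrite !add0r !addr0 => -> ->; ring.
Qed.

End QuadricPencil.

(** * Plane sections with exactly four points *)

Section PlaneSection.
Variable R : realType.
Implicit Types (W : {vspace 'rV[R]_4}) (x y z : 'rV[R]_4).

Lemma card4_uniq5 (S : set (RP3 R)) (s : seq (RP3 R)) :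
  (S #= `I_4)%card -> uniq s -> size s = 5%N -> {in s, forall p, S p} -> False.
Proof.
move=> S4 us ss sS; case: s us ss sS => // p0 s us ss sS.
pose f := nth p0 (p0 :: s).
have finj : {in `I_5%classic &, injective f}.
  move=> i j; rewrite !inE /= => i5 j5 /eqP.
  by rewrite nth_uniq ?ss // => /eqP.
have fS : (f @` `I_5 `<=` S)%classic.
  by move=> _ [i /= i5 <-]; apply: sS; rewrite mem_nth ?ss.
have := subset_card_le fS.
by rewrite (card_le_eql (inj_card_eq finj)) (card_le_eqr S4) card_le_II.
Qed.

Lemma plane_sectionE W (A1 A2 : 'M[R]_4) p x : represents p x ->
  (plane W `&` (quadric A1 `&` quadric A2))%classic p <->
  [/\ x \in W, bil A1 x x = 0 & bil A2 x x = 0].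
Proof.
move=> px; split.
  by move=> [/(planeE _ px) ? [/(quadricE _ px) ? /(quadricE _ px) ?]].
by move=> [xW x1 x2]; split; [exact/(planeE _ px)|split; exact/(quadricE _ px)].
Qed.

(* Three collinear points of a quadric span a line contained in the quadric, so
   the plane section would be infinite. *)
Lemma plane_section_free W (A1 A2 : 'M[R]_4) p1 p2 p3 x1 x2 x3 :
  let S := (plane W `&` (quadric A1 `&` quadric A2))%classic in
  (S #= `I_4)%card -> S p1 -> S p2 -> S p3 ->
  represents p1 x1 -> represents p2 x2 -> represents p3 x3 ->
  p1 != p2 -> p1 != p3 -> p2 != p3 -> free [:: x1; x2; x3].
Proof.
move=> S S4 S1 S2 S3 r1 r2 r3 n12 n13 n23; apply: free3 => a b c e.
(* A vanishing coefficient leaves a relation between two distinct points; there remains the case of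
   three nonzero coefficients. *)
have [c0|c0] := eqVneq c 0.
  move: e; rewrite c0 scale0r addr0.
  by case/(represents_indep n12 r1 r2).
have [a0|a0] := eqVneq a 0.
  by move: e; rewrite a0 scale0r add0r => /(represents_indep n23 r2 r3)[].
have [b0|b0] := eqVneq b 0.
  by move: e; rewrite b0 scale0r addr0 => /(represents_indep n13 r1 r3)[].
exfalso.
move: (S1) => /(plane_sectionE _ _ _ r1)[W1 q11 q21].
move: (S2) => /(plane_sectionE _ _ _ r2)[W2 q12 q22].
move: (S3) => /(plane_sectionE _ _ _ r3)[W3 q13 q23].
have x3E : - c *: x3 = a *: x1 + b *: x2.
  by apply/eqP; rewrite scaleNr eq_sym -addr_eq0 e.
(* Expanding the form at [- c *: x3] leaves only [a * b] times the polar value. *)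
have line A : bil A x1 x1 = 0 -> bil A x2 x2 = 0 -> bil A x3 x3 = 0 ->
    polar A x1 x2 = 0.
  move=> h1 h2 h3; have : bil A (- c *: x3) (- c *: x3) = 0.
    by rewrite !bilE h3 !mulr0.
  rewrite x3E !bilE h1 h2 => h.
  have : a * b * polar A x1 x2 = 0 by rewrite -h /polar; ring.
  by move/eqP; rewrite !mulf_eq0 (negPf a0) (negPf b0) /= => /eqP.
have on_line A i : bil A x1 x1 = 0 -> bil A x2 x2 = 0 -> bil A x3 x3 = 0 ->
    bil A (x1 + i *: x2) (x1 + i *: x2) = 0.
  move=> h1 h2 h3; have := line A h1 h2 h3; rewrite /polar !bilE h1 h2 => h.
  by transitivity (i * (bil A x1 x2 + bil A x2 x1)); [ring|rewrite h mulr0].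
have nz (i : nat) : x1 + i%:R *: x2 != 0.
  apply/eqP; rewrite -{1}[x1]scale1r => /(represents_indep n12 r1 r2)[/eqP].
  by rewrite oner_eq0.
have dim1 i : \dim <[x1 + i%:R *: x2]> == 1%N by rewrite dim_vline nz.
(* The values 0 to 4 of [i] give five distinct points of the line. *)
pose pt i := ProjectivePoint (dim1 i).
have rpt i : represents (pt i) (x1 + i%:R *: x2) by [].
apply: (@card4_uniq5 S [seq pt i | i <- iota 0 5] S4).
- rewrite map_inj_uniq // => i j /(congr1 (@line_of R)) /= /esym/eqP.
  rewrite eqEsubv => /andP[_].
  rewrite -memvE => /vlineP[k eij].
  have : (1 - k) *: x1 + (i%:R - k * j%:R) *: x2 = 0.
    rewrite !scalerBl scale1r -scalerA addrACA eij -opprD -scalerDr.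
    by rewrite subrr.
  case/(represents_indep n12 r1 r2) => /eqP; rewrite subr_eq0 => /eqP <-.
  by rewrite mul1r => /eqP; rewrite subr_eq0 eqr_nat => /eqP.
- by rewrite size_map size_iota.
- move=> _ /mapP[i _ ->]; apply/(plane_sectionE _ _ _ (rpt i)).
  by split; [rewrite rpredD ?rpredZ|exact: on_line|exact: on_line].
Qed.

(* Cayley-Bacharach in the plane: a fifth common point of the two conics would
   appear if their restrictions to W were proportional. *)
Lemma plane_section_pencil W (A1 A2 F : 'M[R]_4) p1 p2 p3 p4 x1 x2 x3 x4 :
  let S := (plane W `&` (quadric A1 `&` quadric A2))%classic in
  \dim W = 3%N -> (S #= `I_4)%card -> S p1 -> S p2 -> S p3 -> S p4 ->
  represents p1 x1 -> represents p2 x2 -> represents p3 x3 ->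
  represents p4 x4 -> uniq [:: p1; p2; p3; p4] ->
  bil F x1 x1 = 0 -> bil F x2 x2 = 0 -> bil F x3 x3 = 0 -> bil F x4 x4 = 0 ->
  exists u v, {in W, forall x, bil (F - u *: A1 - v *: A2) x x = 0}.
Proof.
move=> S dimW S4 S1 S2 S3 S4' r1 r2 r3 r4 u4 F1 F2 F3 F4.
move: (u4); rewrite /= !inE !negb_or.
case/and4P => /and3P[n12 n13 n14] /andP[n23 n24] n34 _.
have fr := plane_section_free S4 S1 S2 S3 r1 r2 r3 n12 n13 n23.
have fr' := plane_section_free S4 S1 S2 S4' r1 r2 r4 n12 n14 n24.
have fr'' := plane_section_free S4 S1 S3 S4' r1 r3 r4 n13 n14 n34.
have fr''' := plane_section_free S4 S2 S3 S4' r2 r3 r4 n23 n24 n34.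
move: (S1) => /(plane_sectionE _ _ _ r1)[W1 q11 q21].
move: (S2) => /(plane_sectionE _ _ _ r2)[W2 q12 q22].
move: (S3) => /(plane_sectionE _ _ _ r3)[W3 q13 q23].
move: (S4') => /(plane_sectionE _ _ _ r4)[W4 q14 q24].
have [a [b [c x4E]]] := mem_plane3 dimW fr W1 W2 W3 W4.
(* No three of the four vectors are dependent, so all coefficients of [x4] are nonzero and the
   points form a projective frame. *)
have a0 : a != 0.
  apply/eqP => a0; have [] // := @free3P _ _ _ _ b c (-1) fr'''.
    by rewrite x4E a0 scale0r add0r scaleN1r subrr.
  by move=> _ _ /eqP; rewrite oppr_eq0 oner_eq0.
have b0 : b != 0.
  apply/eqP => b0; have [] // := @free3P _ _ _ _ a c (-1) fr''.
    by rewrite x4E b0 scale0r addr0 scaleN1r subrr.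
  by move=> _ _ /eqP; rewrite oppr_eq0 oner_eq0.
have c0 : c != 0.
  apply/eqP => c0; have [] // := @free3P _ _ _ _ a b (-1) fr'.
    by rewrite x4E c0 scale0r addr0 scaleN1r subrr.
  by move=> _ _ /eqP; rewrite oppr_eq0 oner_eq0.
(* In these rescaled coordinates the fourth point is [1, 1, 1]. *)
pose e1 := a *: x1; pose e2 := b *: x2; pose e3 := c *: x3.
have z1 A : bil A x1 x1 = 0 -> bil A e1 e1 = 0 by rewrite !bilE => ->; ring.
have z2 A : bil A x2 x2 = 0 -> bil A e2 e2 = 0 by rewrite !bilE => ->; ring.
have z3 A : bil A x3 x3 = 0 -> bil A e3 e3 = 0 by rewrite !bilE => ->; ring.
(* Evaluation at [1, 1, 1] yields the zero coefficient sums required by [conic_pencil]. *)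
have sum0 A : bil A x1 x1 = 0 -> bil A x2 x2 = 0 -> bil A x3 x3 = 0 ->
    bil A x4 x4 = 0 -> polar A e1 e2 + polar A e2 e3 + polar A e1 e3 = 0.
  move=> /z1 h1 /z2 h2 /z3 h3; have := bil_comb3 1 1 1 h1 h2 h3.
  by rewrite !scale1r !mulr1 x4E => -> ->.
have [] := conic_pencil (sum0 _ q11 q12 q13 q14) (sum0 _ q21 q22 q23 q24)
  (sum0 _ F1 F2 F3 F4).
  move=> [u [v [E12 E23 E13]]]; exists u, v => x xW.
  have [a' [b' [c' ->]]] := mem_plane3 dimW fr W1 W2 W3 xW.
  have -> : a' *: x1 + b' *: x2 + c' *: x3 =
      (a' / a) *: e1 + (b' / b) *: e2 + (c' / c) *: e3.
    by rewrite !scalerA !divfK.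
  rewrite bil_comb !bil_comb3; do ?[exact: z1|exact: z2|exact: z3].
  by rewrite E12 E23 E13; ring.
(* The other alternative gives a fifth point of the section. *)
move=> [x [y [z [x0 z0 xz q1 q2]]]]; exfalso.
pose w := x *: e1 + y *: e2 + z *: e3.
have indep (t1 t2 t3 : R) : w = t1 *: x1 + t2 *: x2 + t3 *: x3 ->
    [/\ x * a = t1, y * b = t2 & z * c = t3].
  move=> wE.
  have : (x * a - t1) *: x1 + (y * b - t2) *: x2 + (z * c - t3) *: x3 = 0.
    rewrite !scalerBl [X in X + _]addrACA -opprD addrACA -opprD -wE /w.
    by rewrite !scalerA subrr.
  by case/(free3P fr) => /eqP + /eqP + /eqP;
    rewrite !subr_eq0 => /eqP -> /eqP -> /eqP ->.
have w0 : w != 0.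
  apply/eqP => /esym h; have [] := indep 0 0 0.
    by rewrite -h !scale0r !addr0.
  by move=> /eqP; rewrite mulf_eq0 (negPf x0) (negPf a0).
have [p rp] := represents_point w0.
apply: (@card4_uniq5 S [:: p; p1; p2; p3; p4] S4) => //.
  (* The new point differs from [p1] and [p2] by [z != 0], from [p3] by [x != 0], and from [p4] by
     [x != z]. *)
  rewrite cons_uniq u4 andbT !inE !negb_or; apply/and4P; split.
  - apply: (represents_neq rp r1) => t h.
    have [] := indep t 0 0; first by rewrite h !scale0r !addr0.
    by move=> _ _ /eqP; rewrite mulf_eq0 (negPf z0) (negPf c0).
  - apply: (represents_neq rp r2) => t h.
    have [] := indep 0 t 0; first by rewrite h !scale0r addr0 add0r.
    by move=> _ _ /eqP; rewrite mulf_eq0 (negPf z0) (negPf c0).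
  - apply: (represents_neq rp r3) => t h.
    have [] := indep 0 0 t; first by rewrite h !scale0r !add0r.
    by move=> /eqP; rewrite mulf_eq0 (negPf x0) (negPf a0).
  - apply: (represents_neq rp r4) => t h.
    have [] := indep (t * a) (t * b) (t * c).
      by rewrite h x4E !scalerDr !scalerA.
    move=> /(mulIf a0) xt _ /(mulIf c0) zt.
    by rewrite xt zt eqxx in xz.
move=> q; rewrite in_cons => /predU1P[->|].
  apply/(plane_sectionE _ _ _ rp); split.
  - by rewrite !rpredD ?rpredZ.
  - by rewrite bil_comb3 ?q1 //; [exact: z1|exact: z2|exact: z3].
  - by rewrite bil_comb3 ?q2 //; [exact: z1|exact: z2|exact: z3].
by rewrite !inE => /or4P[] /eqP->.
Qed.

End PlaneSection.

(** * Coplanarity and normalised representatives *)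

Section EighthPoint.
Variable R : realType.

(** Choosing the five points by a bit mask makes distinctness and membership automatic and their
    number computable. *)
Lemma no_five_in_plane (s : seq (RP3 R)) (m : bitseq) W :
  uniq s -> no_five_coplanar s -> size (mask m s) = 5%N -> \dim W = 3%N ->
  {in mask m s, forall p, plane W p} -> False.
Proof.
move=> us no5 sz dimW inW; apply: (no5 (mask m s)) => //.
- exact: mask_uniq.
- by move=> p; apply: mem_mask.
- by exists (plane W) => //; exists W.
Qed.

Lemma circumscribed_plane g (a b c d : RP3 R) : circumscribed g a b c d ->
  exists2 W, \dim W = 3%N & [/\ plane W a, plane W b, plane W c & plane W d].
Proof.
by move=> [_ [_ [W dimW ->] ->] [[_ ?] [_ ?] [_ ?] [_ ?]]]; exists W.
Qed.

(** Places points off [W] in the affine chart where [f] is 1, so that their differences lie in [W],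
    as [vanish_affine_comb] requires. *)
Lemma represents_normalized (f : 'cV[R]_4) (W : {vspace 'rV[R]_4}) (p : RP3 R) :
  (forall x, (x \in W) = ((x *m f) 0 0 == 0)) ->
  ~ plane W p ->
  exists2 x, represents p x & (x *m f) 0 0 = 1.
Proof.
move=> WE np; have [x rp] := represents_exists p.
have fx : (x *m f) 0 0 != 0.
  by rewrite -WE; apply/negP => /(planeE _ rp)/np.
exists (((x *m f) 0 0)^-1 *: x); first by apply: representsZ; rewrite ?invr_eq0.
by rewrite -scalemxAl mxE mulVf.
Qed.

End EighthPoint.

(** * The eighth line *)

Theorem theorem8p6 (R : realType) (g : geometry) (C : set (RP3 R))
    (l1 l2 l3 l4 m1 m2 m3 m4 : RP3 R) :
  hypercycle_base_curve g C ->
  (forall l, l \in [:: l1; l2; l3; l4; m1; m2; m3; m4] ->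
     touches_hypercycle g C l) ->
  generic C l1 l2 l3 l4 m1 m2 m3 m4 ->
  circumscribed g l1 l2 m1 m2 ->
  circumscribed g l2 l3 m2 m3 ->
  circumscribed g l3 l4 m3 m4 ->
  circumscribed g l1 l4 m1 m4.
Proof.
move=> [_ [[A2 [_ _ ->]] _ ->]] touch [u8 no5 four12 four34].
pose A1 : 'M[R]_4 := laguerre_mx R g.
move=> /circumscribed_plane[W12 d12 [P12l1 P12l2 P12m1 P12m2]].
move=> /circumscribed_plane[W23 d23 [P23l2 P23l3 P23m2 P23m3]].
move=> /circumscribed_plane[W34 d34 [P34l3 P34l4 P34m3 P34m4]].
pose s := [:: l1; l2; l3; l4; m1; m2; m3; m4].
have in8 k : (k < 8)%N -> nth l1 s k \in s by exact: (@mem_nth _ l1 s k).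
have l1in : l1 \in s by exact: (in8 0%N).
have l2in : l2 \in s by exact: (in8 1%N).
have l3in : l3 \in s by exact: (in8 2%N).
have l4in : l4 \in s by exact: (in8 3%N).
have m1in : m1 \in s by exact: (in8 4%N).
have m2in : m2 \in s by exact: (in8 5%N).
have m3in : m3 \in s by exact: (in8 6%N).
have m4in : m4 \in s by exact: (in8 7%N).
have c12 : (plane W12 `&` (quadric A1 `&` quadric A2) #= `I_4)%card.
  by rewrite -laguerre_quadricE; apply: four12 => //; exists W12.
have c34 : (plane W34 `&` (quadric A1 `&` quadric A2) #= `I_4)%card.
  by rewrite -laguerre_quadricE; apply: four34 => //; exists W34.
have onS l x : l \in s ->
    represents l x -> bil A1 x x = 0 /\ bil A2 x x = 0.
  move=> /touch[_ []]; rewrite laguerre_quadricE.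
  by move=> /quadricE + /quadricE + r => /(_ _ r) -> /(_ _ r) ->.
(* Each of these points would be a fifth one in the plane of [l1], [l2], [m1], [m2]. *)
have [n3 n4 k3 k4] : [/\ ~ plane W12 l3, ~ plane W12 l4, ~ plane W12 m3
    & ~ plane W12 m4].
  split=> P5.
  - apply: (no_five_in_plane (m := [:: true; true; true; false; true; true])
      u8 no5 erefl d12) => p; rewrite !inE.
    by case/or4P => [||| /orP[]] /eqP->.
  - apply: (no_five_in_plane (m := [:: true; true; false; true; true; true])
      u8 no5 erefl d12) => p; rewrite !inE.
    by case/or4P => [||| /orP[]] /eqP->.
  - apply: (no_five_in_plane
      (m := [:: true; true; false; false; true; true; true])
      u8 no5 erefl d12) => p; rewrite !inE.
    by case/or4P => [||| /orP[]] /eqP->.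
  - apply: (no_five_in_plane
      (m := [:: true; true; false; false; true; true; false; true])
      u8 no5 erefl d12) => p; rewrite !inE.
    by case/or4P => [||| /orP[]] /eqP->.
have notin23 : ~ plane W23 m4.
  move=> P5; apply: (no_five_in_plane
      (m := [:: false; true; true; false; false; true; true; true])
      u8 no5 erefl d23) => p; rewrite !inE.
  by case/or4P => [||| /orP[]] /eqP->.
have [f12 f12E] := plane_form d12; have [f23 f23E] := plane_form d23.
have [x1 r1] := represents_exists l1; have [x2 r2] := represents_exists l2.
have [y1 s1] := represents_exists m1; have [y2 s2] := represents_exists m2.
have [x3 r3 f3] := represents_normalized f12E n3.
have [x4 r4 f4] := represents_normalized f12E n4.
have [y3 s3 g3] := represents_normalized f12E k3.
have [y4 s4 g4] := represents_normalized f12E k4.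
have [f14 f14n0 [f14x1 f14x4 f14y1]] := form_through x1 x4 y1.
pose F := f23 *m f14^T.
have F23 l x : represents l x -> plane W23 l -> bil F x x = 0.
  by move=> r /(planeE _ r); rewrite f23E bil_prod => /eqP ->; rewrite mul0r.
have F14 x : (x *m f14) 0 0 = 0 -> bil F x x = 0.
  by rewrite bil_prod => ->; rewrite mulr0.
have inS W l x : l \in s ->
    represents l x -> plane W l ->
    (plane W `&` (quadric A1 `&` quadric A2))%classic l.
  move=> lin r Wl; apply/(plane_sectionE _ _ _ r).
  by have [? ?] := onS _ _ lin r; split=> //; exact/(planeE _ r).
have u12 : uniq [:: l1; l2; m1; m2].
  exact: (mask_uniq u8 [:: true; true; false; false; true; true]).
(* The factor [f14] vanishes at [l1] and [m1], the factor [f23] at [l2] and [m2]. *)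
have [u [v G12]] : exists u v,
    {in W12, forall x, bil (F - u *: A1 - v *: A2) x x = 0}.
  apply: (plane_section_pencil d12 c12
    (inS _ _ _ l1in r1 P12l1) (inS _ _ _ l2in r2 P12l2)
    (inS _ _ _ m1in s1 P12m1) (inS _ _ _ m2in s2 P12m2) r1 r2 s1 s2 u12).
  - exact: F14.
  - exact: F23 r2 P23l2.
  - exact: F14.
  - exact: F23 s2 P23m2.
set G := F - _ - _ in G12.
(* Both quadrics vanish at all eight points, where [G] and [F] therefore agree. *)
have GF l x : l \in s ->
    represents l x -> bil G x x = bil F x x.
  move=> lin r; have [h1 h2] := onS _ _ lin r.
  by rewrite bil_comb h1 h2 !mulr0 !subr0.
have /= u34 := mask_uniq u8 [:: false; false; true; true; false; false; true].
have fr34 : free [:: x3; x4; y3].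
  move: u34; rewrite !inE negb_or => /and3P[/andP[n34 nl3] nl4 _].
  exact: (plane_section_free c34 (inS _ _ _ l3in r3 P34l3)
    (inS _ _ _ l4in r4 P34l4) (inS _ _ _ m3in s3 P34m3) r3 r4 s3).
have [a [b [c y4E]]] := mem_plane3 d34 fr34 (iffLR (planeE _ r3) P34l3)
  (iffLR (planeE _ r4) P34l4) (iffLR (planeE _ s3) P34m3)
  (iffLR (planeE _ s4) P34m4).
(* Apply [f12], which is 1 at all four normalised vectors. *)
have abc : a + b + c = 1.
  by rewrite -g4 y4E form_comb f3 f4 g3 !mulr1.
have Gy4 : bil G y4 y4 = 0.
  rewrite y4E; apply: (vanish_affine_comb G12) => //.
  - by rewrite f12E formB f3 f4 subrr.
  - by rewrite f12E formB f3 g3 subrr.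
  - by rewrite (GF _ _ l3in r3); exact: F23 r3 P23l3.
  - by rewrite (GF _ _ l4in r4); apply: F14.
  - by rewrite (GF _ _ m3in s3); exact: F23 s3 P23m3.
(* One factor of [F] vanishes at [m4], and it is not [f23]. *)
have f14y4 : (y4 *m f14) 0 0 = 0.
  move: Gy4; rewrite (GF _ _ m4in s4) bil_prod => /eqP.
  rewrite mulf_eq0 => /orP[|/eqP //].
  by rewrite -f23E => /(planeE _ s4).
have [W14 d14 W14E] := ker_form f14n0.
exists (laguerre_quadric g `&` plane W14)%classic.
  by exists (plane W14) => //; exists W14.
have in14 l x : l \in s -> represents l x ->
    (x *m f14) 0 0 = 0 -> (laguerre_quadric g `&` plane W14)%classic l.
  move=> /touch[_ [? _]] r x0; split=> //.
  by apply/(planeE _ r); rewrite W14E x0.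
by split; [exact: in14 l1in r1 _|exact: in14 l4in r4 _|exact: in14 m1in s1 _
  |exact: in14 m4in s4 _].
Qed.
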